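(* Let $N\ge1$ be an integer and let $\ell,\tau,\alpha,\beta,\gamma,\delta>0$ and $\tilde u_1^k,\dots,\tilde u_N^k\in\mathbb R$. The $N\times N$ matrices $$\mathcal T_N^k=\mathcal H_N+\frac{2\tau^2}{\ell^2}\,q_{k,N}\,\mathcal I_N,\qquad \mathcal T_N=\mathcal H_N+\frac{a_0\tau^2}{\ell^2}\,\gamma\,\mathcal I_N$$ are positive definite, where $q_{k,N}=\alpha+\beta\sum_{m=1}^N(\tilde u_m^k)^2$ and $a_0=\dfrac{4}{2+\delta\tau^2}$.
   Context: $\mathcal I_N$ is the identity matrix of order $N$. With $A_m=1/\sqrt{2m+1}$ for $m\ge0$, the matrix $\mathcal H_N=(h_{i,j})_{1\le i,j\le N}$ is the symmetric matrix with entries $h_{i,i}=2A_{i-1}^2A_{i+1}^2$ for $i=1,\dots,N$, $h_{i,i+2}=h_{i+2,i}=-A_iA_{i+1}^2A_{i+2}$ for $i=1,\dots,N-2$, and all other entries zero. These are the coefficient matrices of the Legendre–Galerkin linear systems, with trial and test functions $\phi_m(x)=\int_0^x\widehat P_m(s)\,ds$, $m=1,\dots,N$ ($\widehat P_m$ the orthonormal shifted Legendre polynomial of degree $m$ on $[0,\ell]$), for the equations $w-\frac{\tau^2}{2}q\,w''=g_1$ with $q=q_{k,N}$, and $\left(1+\frac{\tau^2}{2}\delta\right)w-\frac{\tau^2}{2}\gamma w''=g_2$, each with $w(0)=w(\ell)=0$; the numbers $\tilde u_m^k$ are the expansion coefficients of the approximate solution $\sum_m\tilde u_m^k\phi_m$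 at time layer $k$. *)

(* Defs.v *)
From mathcomp Require Import all_boot all_order all_algebra.
From mathcomp Require Import reals.

Set Implicit Arguments.
Unset Strict Implicit.
Unset Printing Implicit Defensive.

Import Order.TTheory GRing.Theory Num.Theory.
Local Open Scope ring_scope.

Definition positive_definite (R : realType) (n : nat) (M : 'M[R]_n) : Prop :=
  M^T = M /\ forall x : 'cV[R]_n, x != 0 -> 0 < (x^T *m M *m x) 0 0.

Definition A (R : realType) (m : nat) : R := 1 / Num.sqrt (2 * m%:R + 1).

(* The indices i, j are 1-based; [A R i.-1] is only meant for i >= 1. *)
Definition h (R : realType) (i j : nat) : R :=
  if j == i then 2 * A R i.-1 ^+ 2 * A R i.+1 ^+ 2
  else if j == i.+2 then - (A R i * A R i.+1 ^+ 2 * A R i.+2)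
  else if i == j.+2 then - (A R j * A R j.+1 ^+ 2 * A R j.+2)
  else 0.

(* Ordinals are 0-based, hence the shift. *)
Definition H (R : realType) (N : nat) : 'M[R]_N :=
  \matrix_(i < N, j < N) h R i.+1 j.+1.

(* [u m] is the coefficient of index m + 1. *)
Definition q (R : realType) (N : nat) (alpha beta : R) (u : 'I_N -> R) : R :=
  alpha + beta * \sum_(m < N) u m ^+ 2.

Definition a0 (R : realType) (delta tau : R) : R := 4 / (2 + delta * tau ^+ 2).

Definition T_layer (R : realType) (N : nat) (l tau alpha beta : R)
    (u : 'I_N -> R) : 'M[R]_N :=
  H R N + (2 * tau ^+ 2 / l ^+ 2 * q alpha beta u)%:M.

Definition T_fixed (R : realType) (N : nat) (l tau gamma delta : R) : 'M[R]_N :=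
  H R N + (a0 delta tau * tau ^+ 2 / l ^+ 2 * gamma)%:M.

(* Main.v *)
Require Import Defs.
From mathcomp Require Import all_boot all_order all_algebra.
From mathcomp Require Import reals.
From mathcomp Require Import zify ring lra.

Import Order.TTheory GRing.Theory Num.Theory.
Local Open Scope ring_scope.

(** The matrix [H R N] is the Gram matrix of the functions [phi_1], ...,
    [phi_N] in L^2 (up to a constant factor, with
    [phi_m] the integral from 0 of the orthonormal shifted Legendre polynomial
    of degree [m]), hence positive semidefinite;
    adding a positive multiple of the identity makes it positive definite, and
    the multiples in [T_layer] and [T_fixed] are positive.

    The Gram structure is made algebraic as follows.  Integrating a Legendre
    polynomial gives a combination of its two neighbours: up to a common
    factor, [phi_i] is [A_i (A_(i+1) p_(i+1) - A_(i-1) p_(i-1))], where the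
    [p_k] are the orthonormal Legendre polynomials of degree [k].  Taking the
    coordinates of the [phi_i] on [p_0], ..., [p_(N+1)] as the rows of a matrix
    [V], orthonormality turns the Gram matrix into [V *m V^T].  The entries of
    this product agree with those of [H R N] ([H_gram]): off the diagonal, the
    rows of [phi_i] and [phi_(i+2)] overlap exactly in the coordinate on
    [p_(i+1)], and on the diagonal one uses
    [A_i^2 (A_(i-1)^2 + A_(i+1)^2) = 2 A_(i-1)^2 A_(i+1)^2]. *)

Lemma mulmx_tr_sqr (R : comPzRingType) (n : nat) (y : 'cV[R]_n) :
  (y^T *m y) 0 0 = \sum_i y i 0 ^+ 2.
Proof. by rewrite mxE; apply: eq_bigr => i _; rewrite mxE expr2. Qed.

(** The quadratic form at [x] is [|V^T x|^2 + c |x|^2]. *)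
Lemma gram_add_scalar_positive_definite (R : realType) (n p : nat)
    (V : 'M[R]_(n, p)) (c : R) :
  0 < c -> positive_definite (V *m V^T + c%:M).
Proof.
move=> c_gt0; split; first by rewrite linearD /= trmx_mul trmxK tr_scalar_mx.
move=> x x_neq0.
have -> : x^T *m (V *m V^T + c%:M) *m x
    = (V^T *m x)^T *m (V^T *m x) + c *: (x^T *m x).
  by rewrite mulmxDr mulmxDl mul_mx_scalar -scalemxAl trmx_mul trmxK !mulmxA.
rewrite mxE [X in _ + X]mxE !mulmx_tr_sqr ltr_wpDl //.
  by apply: sumr_ge0 => i _; apply: sqr_ge0.
rewrite mulr_gt0 // lt_neqAle sumr_ge0 ?andbT => [|i _]; last exact: sqr_ge0.
apply: contra x_neq0 => /eqP/esym sum0; apply/eqP/matrixP => i j.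
rewrite ord1 mxE; apply/eqP; rewrite -sqrf_eq0; apply/eqP.
by apply: (psumr_eq0P _ sum0) => // k _; apply: sqr_ge0.
Qed.

(** Row [i] lists the coordinates of (a multiple of) [phi_(i+1)] on the
    orthonormal Legendre polynomials of degrees [0], ..., [N + 1]. *)
Definition legendre_coords (R : realType) (N : nat) : 'M[R]_(N, N.+2) :=
  \matrix_(i < N, k < N.+2)
    (A R i.+1 * (A R i.+2 * (k == i.+2 :> nat)%:R - A R i * (k == i :> nat)%:R)).

Lemma sum_mul_delta (R : pzRingType) (n m : nat) (f : nat -> R) :
  (m < n)%N -> \sum_(k < n) f k * (k == m :> nat)%:R = f m.
Proof.
move=> lt_mn; rewrite (bigD1 (Ordinal lt_mn)) //= eqxx mulr1 big1 ?addr0 // => k.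
by rewrite -val_eqE /= => /negPf->; rewrite mulr0.
Qed.

Lemma sqr_A (R : realType) (m : nat) : A R m ^+ 2 = (2 * m%:R + 1)^-1.
Proof.
by rewrite /A div1r exprVn sqr_sqrtr // addr_ge0 // mulr_ge0 // ler0n.
Qed.

(** Since [A_m^2 = 1 / (2 m + 1)], this is the partial fraction identity
    [1 / (2 i + 1) + 1 / (2 i + 5) = 2 (2 i + 3) / ((2 i + 1) (2 i + 5))]. *)
Lemma sqr_A_neighbours (R : realType) (i : nat) :
  A R i.+1 ^+ 2 * (A R i ^+ 2 + A R i.+2 ^+ 2) = 2 * A R i ^+ 2 * A R i.+2 ^+ 2.
Proof.
rewrite !sqr_A -[i.+2%:R]natr1 -[i.+1%:R]natr1.
have i_ge0 : 0 <= i%:R :> R by apply: ler0n.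
by field; apply/and3P; split; apply: lt0r_neq0; lra.
Qed.

Lemma H_gram (R : realType) (N : nat) :
  H R N = legendre_coords R N *m (legendre_coords R N)^T.
Proof.
apply/matrixP => i j; rewrite !mxE.
pose f k : R :=
  A R i.+1 * (A R i.+2 * (k == i.+2)%:R - A R i * (k == i)%:R) * A R j.+1.
(* Row [j] has only two nonzero entries, which collapses the sum over [k]. *)
have -> : \sum_k legendre_coords R N i k * (legendre_coords R N)^T k j
    = A R j.+2 * f j.+2 - A R j * f j.
  have ltj := ltn_ord j.
  rewrite -(@sum_mul_delta _ N.+2 j.+2 f) // -(@sum_mul_delta _ N.+2 j f); last lia.
  rewrite !mulr_sumr -sumrB; apply: eq_bigr => k _.
  by rewrite !mxE /f; ring.
rewrite /f /h !eqSS /=.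
have [->|ne_ji] := eqVneq (j : nat) i.
  have -> : (i.+2 == i) = false by lia.
  have -> : (i == i.+2 :> nat) = false by lia.
  by rewrite -sqr_A_neighbours /= mulr1n mulr0n; ring.
have [->|ne_ji2] := eqVneq (j : nat) i.+2.
  have -> : (i.+4 == i) = false by lia.
  by rewrite mulr1n mulr0n; ring.
have [->|ne_ij2] := eqVneq (i : nat) j.+2; by rewrite ?mulr1n mulr0n; ring.
Qed.

Theorem theorem7p4 (R : realType) (N : nat) (hN : (1 <= N)%N)
    (l tau alpha beta gamma delta : R)
    (hl : 0 < l) (htau : 0 < tau) (halpha : 0 < alpha) (hbeta : 0 < beta)
    (hgamma : 0 < gamma) (hdelta : 0 < delta) (u : 'I_N -> R) :
  positive_definite (T_layer l tau alpha beta u) /\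
  positive_definite (T_fixed N l tau gamma delta).
Proof.
have q_gt0 : 0 < q alpha beta u.
  rewrite ltr_wpDr // mulr_ge0 ?(ltW hbeta) //.
  by apply: sumr_ge0 => m _; apply: sqr_ge0.
have a0_gt0 : 0 < a0 delta tau.
  by rewrite divr_gt0 ?ltr0n // addr_gt0 // mulr_gt0 // exprn_gt0.
rewrite /T_layer /T_fixed H_gram.
split; apply: gram_add_scalar_positive_definite.
  by rewrite mulr_gt0 // divr_gt0 ?exprn_gt0 // mulr_gt0 ?exprn_gt0.
by rewrite mulr_gt0 // divr_gt0 ?exprn_gt0 // mulr_gt0 ?exprn_gt0.
Qed.
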